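(* Let $H$ be an $n$-vertex graph with maximum degree $\Delta$ and average degree $d$, and suppose that $\chi(H)\ge 3$. Then $ER(H)>2^{\lceil nd/(2\Delta)\rceil-1}$.
   Context: $\chi(H)$ is the chromatic number. Edge-colorings of $K_N$ may use arbitrarily many colors. A copy of $H$ in $K_N$ (injective $\varphi:V(H)\to V(K_N)$) is canonically colored if it is monochromatic (all edges same color), rainbow (all edges distinct colors), or lexicographic: there is an ordering $v_1,\dots,v_n$ of $V(H)$ such that for each $i$ all edges $\varphi(v_i)\varphi(v_j)$ with $v_iv_j\in E(H)$, $j>i$, have the same color $c_i$, and these colors are distinct for different $v_i$. $ER(H)$ is the least $N$ such that every edge-coloring of $K_N$ contains a canonically colored copy of $H$. *)

(* Defs.v *)
From HB Require Import structures.
From mathcomp Require Import all_boot all_order all_algebra.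

Set Implicit Arguments.
Unset Strict Implicit.
Unset Printing Implicit Defensive.

Record sgraph := SGraph {
  vertex :> finType;
  adj : rel vertex;
  adj_sym : symmetric adj;
  adj_irrefl : irreflexive adj
}.

Definition edges (H : sgraph) : {set {set H}} :=
  [set [set x; y] | x in H, y in H & adj x y].

Definition degree (H : sgraph) (x : H) : nat := #|[set y | adj x y]|.

Definition max_degree (H : sgraph) : nat := \max_(x : H) degree x.

Definition average_degree (H : sgraph) : rat :=
  ((\sum_(x : H) degree x)%N%:R / #|H|%:R)%R.

Definition colorable (H : sgraph) (k : nat) : bool :=
  [exists f : {ffun H -> 'I_k}, [forall x, forall y, adj x y ==> (f x != f y)]].

Lemma colorable_exists (H : sgraph) : exists k, colorable H k.
Proof.
exists #|H|; apply/existsP; exists [ffun x => enum_rank x].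
apply/forallP => x; apply/forallP => y; apply/implyP; rewrite !ffunE.
by apply: contraTneq => /enum_rank_inj ->; rewrite adj_irrefl.
Qed.

Definition chromatic_number (H : sgraph) : nat := ex_minn (colorable_exists H).

(* An edge-coloring of K_N assigns a color in nat to each 2-subset of 'I_N;
   its values on the other subsets are never used.  As K_N is finite, colors
   in nat amount to arbitrarily many colors. *)
Definition edge_coloring (N : nat) := {set 'I_N} -> nat.

Section Canonical.
Variables (H : sgraph) (N : nat) (col : edge_coloring N) (phi : H -> 'I_N).

Definition monochromatic : Prop :=
  exists c : nat, forall e, e \in edges H -> col (phi @: e) = c.

Definition rainbow : Prop :=
  {in edges H &, injective (fun e : {set H} => col (phi @: e))}.

(* c i is unconstrained, apart from injectivity, when v i has no later
   neighbor; it can then be taken to be any unused natural number. *)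
Definition lexicographic : Prop :=
  exists (v : 'I_#|H| -> H) (c : 'I_#|H| -> nat),
    [/\ bijective v, injective c &
        forall i j : 'I_#|H|, i < j -> adj (v i) (v j) ->
          col [set phi (v i); phi (v j)] = c i].

Definition canonically_colored : Prop :=
  [\/ monochromatic, rainbow | lexicographic].

End Canonical.

Definition canonical_ramsey (H : sgraph) (N : nat) : Prop :=
  forall col : edge_coloring N,
    exists phi : H -> 'I_N, injective phi /\ canonically_colored col phi.

(* N = ER(H).  Such an N exists for every H by the Erdos-Rado canonical Ramsey
   theorem. *)
Definition is_ER (H : sgraph) (N : nat) : Prop :=
  canonical_ramsey H N /\ forall M, canonical_ramsey H M -> N <= M.

(* Main.v *)
(** Write [m = nd/2] for the number of edges of [H].  Identify the vertices of
    [K_N], [N <= 2^k], with distinct subsets of a [k]-element set and color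
    each pair by an element on which its two subsets differ.  This uses at most
    [k] colors and every color class is bipartite, so no copy of [H] is
    monochromatic when [chi(H) >= 3].  In a rainbow or lexicographic copy every
    color class lies in a star, hence has at most [Delta] edges, so that
    [m <= k * Delta].  This fails for [k = ceil (m / Delta) - 1]. *)

Require Import Defs.
From HB Require Import structures.
From mathcomp Require Import all_boot all_order all_algebra.

Set Implicit Arguments.
Unset Strict Implicit.
Unset Printing Implicit Defensive.

Import Order.TTheory GRing.Theory Num.Theory.
Local Open Scope ring_scope.

Lemma ltn_chromatic_number (H : sgraph) (k : nat) :
  (k < chromatic_number H)%N -> ~~ colorable H k.
Proof.
rewrite /chromatic_number; case: ex_minnP => m _ min_m lt_km.
by apply: contraL lt_km => /min_m; rewrite leqNgt.
Qed.

Lemma colorable2 (H : sgraph) (f : H -> bool) :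
  (forall x y, adj x y -> f x != f y) -> colorable H 2.
Proof.
move=> fP; apply/existsP; exists [ffun x => inord (f x)].
apply/forallP => x; apply/forallP => y; apply/implyP => /fP; rewrite !ffunE.
by apply: contraNneq => /(congr1 val); rewrite /= !inordK; case: (f x) (f y) => [] [].
Qed.

Lemma exists_adj (H : sgraph) : ~~ colorable H 2 -> exists x y : H, adj x y.
Proof.
move=> ncol; have [/existsP[x /existsP[y xy]]|noE] :=
  boolP [exists x : H, exists y : H, adj x y]; first by exists x, y.
case/negP: ncol; apply: (@colorable2 _ xpred0) => x y xy.
by case/negP: noE; apply/existsP; exists x; apply/existsP; exists y.
Qed.

Lemma leq_degree (H : sgraph) (x : H) : (degree x <= max_degree H)%N.
Proof. exact: leq_bigmax. Qed.

Lemma leq_sum_degree (H : sgraph) (x : H) : (degree x <= \sum_(y : H) degree y)%N.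
Proof. by rewrite (bigD1 x) //= leq_addr. Qed.

Lemma adj_degree_gt0 (H : sgraph) (x y : H) : adj x y -> (0 < degree x)%N.
Proof. by move=> xy; apply/card_gt0P; exists y; rewrite inE. Qed.

Lemma sum_degreeE (H : sgraph) :
  (\sum_(x : H) degree x = #|[set p : H * H | adj p.1 p.2]|)%N.
Proof.
rewrite -sum1_card (eq_bigl (fun p : H * H => true && adj p.1 p.2)); last first.
  by move=> p; rewrite inE.
rewrite -(pair_big_dep xpredT (fun x y : H => adj x y) (fun _ _ => 1%N)) /=.
apply: eq_bigr => x _; rewrite /degree -sum1_card.
by apply: eq_bigl => y; rewrite inE.
Qed.

(** Edges are counted as ordered pairs, so a star at [v] splits into the pairs leaving [v] and those
    entering it, at most [max_degree H] of each kind. This gives the factor 2, which matches the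
    degree sum counting each edge twice. *)
Lemma card_star (H : sgraph) (v : H) (A : {set H * H}) :
    (forall p, p \in A -> adj p.1 p.2 /\ (v = p.1 \/ v = p.2)) ->
  (#|A| <= 2 * max_degree H)%N.
Proof.
move=> AP; pose N := [set y | adj v y].
have cardN (f : H -> H * H) : (#|f @: N| <= max_degree H)%N.
  exact: leq_trans (leq_imset_card _ _) (leq_degree v).
have /subset_leq_card/leq_trans : A \subset [set (v, y) | y in N] :|: [set (y, v) | y in N].
  apply/subsetP => -[x y] /AP[/= xy [] Dv]; rewrite in_setU; apply/orP; [left|right].
    by rewrite -Dv in xy *; apply/imsetP; exists y; rewrite ?inE.
  by rewrite -Dv in xy *; apply/imsetP; exists x; rewrite ?inE 1?adj_sym.
apply; rewrite cardsU mul2n -addnn.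
by apply: leq_trans (leq_subr _ _) _; apply: leq_add.
Qed.

Lemma sum_degree_star_coloring (H : sgraph) (k : nat) (f : H -> H -> nat) :
    (forall x y, adj x y -> (f x y < k)%N) ->
    (forall x y, adj x y -> exists v, forall x' y',
       adj x' y' -> f x' y' = f x y -> v = x' \/ v = y') ->
  (\sum_(x : H) degree x <= k * (2 * max_degree H))%N.
Proof.
move=> fk star; rewrite sum_degreeE.
pose A (i : 'I_k) := [set p : H * H | adj p.1 p.2 & f p.1 p.2 == i].
have /subset_leq_card/leq_trans : [set p : H * H | adj p.1 p.2] \subset \bigcup_i A i.
  apply/subsetP => p; rewrite inE => pE; apply/bigcupP.
  by exists (Ordinal (fk _ _ pE)); rewrite // inE pE /=.
apply; apply: (@leq_trans (\sum_i #|A i|)%N).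
  elim/big_ind2: _ => [|B m C p leB leC|//]; first by rewrite cards0.
  by rewrite cardsU (leq_trans (leq_subr _ _)) ?leq_add.
rewrite -[k in (k * _)%N]card_ord -sum_nat_const; apply: leq_sum => i _.
(* A center is only supplied by an edge of the class, so an empty class is treated apart. *)
have [->|[[x0 y0]]] := set_0Vmem (A i); first by rewrite cards0.
rewrite inE /= => /andP[/star[v vP] /eqP fi]; apply: (@card_star _ v) => p.
move: vP; rewrite inE fi => vP /andP[pE /eqP fp]; split=> //; exact: vP.
Qed.

Lemma edgesP (H : sgraph) (e : {set H}) :
  reflect (exists x y, adj x y /\ e = [set x; y]) (e \in edges H).
Proof.
apply: (iffP imset2P) => [[x y _]|[x [y [xy ->]]]].
  by rewrite !inE => /andP[_ xy] ->; exists x, y.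
by exists x y; rewrite ?inE.
Qed.

Lemma imset_set2 (aT rT : finType) (f : aT -> rT) (x y : aT) :
  f @: [set x; y] = [set f x; f y].
Proof. by rewrite imsetU1 imset_set1. Qed.

Section StarClasses.
Variables (H : sgraph) (N : nat) (col : edge_coloring N) (phi : H -> 'I_N).

(** The center [v] is taken in [H] rather than in [K_N], so that degrees in [H] bound the size of a
    color class. *)
Let star_classes := forall x y, adj x y -> exists v, forall x' y',
  adj x' y' -> col [set phi x'; phi y'] = col [set phi x; phi y] ->
  v = x' \/ v = y'.

(** Each class is a single edge, so either endpoint serves as its center. *)
Lemma rainbow_star_classes : rainbow col phi -> star_classes.
Proof.
move=> rb x y xy; exists x => x' y' xy' eq_col.
have /setP/(_ x) : [set x'; y'] = [set x; y].
  by apply: rb; rewrite ?imset_set2 //; apply/edgesP; [exists x', y'|exists x, y].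
by rewrite !inE eqxx => /orP[] /eqP ->; [left|right].
Qed.

Lemma lexicographic_star_classes : lexicographic col phi -> star_classes.
Proof.
move=> [v [c [[w vK wK] c_inj lex]]].
(* An edge takes the color of its earlier endpoint in the ordering. Since [c] is injective, the
   color determines this endpoint, which is therefore the center of the class. *)
have first x y : adj x y -> exists i,
    (v i = x \/ v i = y) /\ col [set phi x; phi y] = c i.
  move=> xy; have [lt_xy|lt_yx|/val_inj eq_xy] := ltngtP (w x) (w y).
  - exists (w x); split; first by left.
    by rewrite -[in LHS](wK x) -[in LHS](wK y) lex ?wK.
  - exists (w y); split; first by right.
    by rewrite setUC -[in LHS](wK x) -[in LHS](wK y) lex ?wK // adj_sym.
  - by rewrite -(wK x) eq_xy wK adj_irrefl in xy.
move=> x y /first[i [_ ->]]; exists (v i) => x' y' /first[j [vj ->]] /c_inj <-.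
by case: vj; [left|right].
Qed.

End StarClasses.

(** The vertex [x] is encoded by a subset [g x] of ['I_k], and [b c x] says whether the element [c]
    lies in it. Thus [b c] is a bipartition of the class of color [c]. *)
Lemma bipartite_coloring (N k : nat) : (N <= 2 ^ k)%N ->
  exists (col : edge_coloring N) (b : nat -> 'I_N -> bool),
    forall x y, x != y -> (col [set x; y] < k)%N /\
      b (col [set x; y]) x != b (col [set x; y]) y.
Proof.
move=> leN.
have leN' : (N <= #|{: {set 'I_k}}|)%N.
  by rewrite -cardsT -powersetT card_powerset cardsT card_ord.
pose g (x : 'I_N) : {set 'I_k} := enum_val (widen_ord leN' x).
have g_inj : injective g.
  by move=> x y /enum_val_inj/(congr1 val) /= /val_inj.
pose sep (e : {set 'I_N}) (i : 'I_k) :=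
  [exists x in e, exists y in e, (i \in g x) && (i \notin g y)].
(* The default [0] is never reached on a pair of distinct vertices: with no separating element their
   subsets would coincide, against the injectivity of [g]. *)
exists (fun e => if [pick i | sep e i] is Some i then val i else 0%N).
exists (fun c x => [exists i : 'I_k, (val i == c) && (i \in g x)]).
have bE (i : 'I_k) x : [exists j : 'I_k, (val j == i) && (j \in g x)] = (i \in g x).
  apply/existsP/idP => [[j /andP[/eqP/val_inj -> //]]|ix].
  by exists i; rewrite eqxx.
move=> x y neq_xy; case: pickP => [i|nsep].
  case/exists_inP => u; rewrite !inE => u_xy /exists_inP[v].
  rewrite !inE => v_xy /andP[iu niv]; rewrite !bE ltn_ord; split=> //.
  by case/orP: u_xy iu => /eqP-> iu; case/orP: v_xy niv => /eqP->;
    rewrite iu // => /negPf->.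
case/eqP: neq_xy; apply: g_inj; apply/setP => i; move/negbT: (nsep i) => ns.
apply/idP/idP => ix; apply: contraNT ns => niy; apply/exists_inP.
  by exists x; rewrite ?set21 //; apply/exists_inP; exists y; rewrite ?set22 ?ix.
by exists y; rewrite ?set22 //; apply/exists_inP; exists x; rewrite ?set21 ?ix.
Qed.

Lemma canonical_ramsey_sum_degree (H : sgraph) (N k : nat) :
    ~~ colorable H 2 -> canonical_ramsey H N -> (N <= 2 ^ k)%N ->
  (\sum_(x : H) degree x <= k * (2 * max_degree H))%N.
Proof.
move=> ncol ramsey /bipartite_coloring[col [b colP]].
have [phi [phi_inj can]] := ramsey col.
have phiP x y : adj x y -> phi x != phi y.
  by apply: contraTneq => /phi_inj ->; rewrite adj_irrefl.
have from_star := @sum_degree_star_coloring H k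
  (fun x y => col [set phi x; phi y]) (fun x y xy => (colP _ _ (phiP x y xy)).1).
case: can => [[c mono]|/rainbow_star_classes/from_star //|
              /lexicographic_star_classes/from_star //].
(* If all edges of the copy have color [c], the bipartition [b c] pulls back along [phi] to a proper
   2-coloring of [H]. *)
case/negP: ncol; apply: (@colorable2 _ (fun x => b c (phi x))) => x y xy.
have <- : col [set phi x; phi y] = c.
  by rewrite -imset_set2; apply: mono; apply/edgesP; exists x, y.
by case: (colP _ _ (phiP x y xy)).
Qed.

Theorem theorem2p3 (H : sgraph) (n Delta : nat) (d : rat)
    (hn : #|H| = n) (hDelta : max_degree H = Delta)
    (hd : average_degree H = d) (hchi : (3 <= chromatic_number H)%N)
    (ER : nat) (hER : is_ER H ER) :
  (2 : rat) ^ (Num.ceil (n%:R * d / (2 * Delta%:R)) - 1) < ER%:R.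
Proof.
have ncol := ltn_chromatic_number hchi; have [ramsey _] := hER.
(* One edge makes [n], [Delta] and the degree sum [s] positive, so the divisions are genuine and the
   ceiling is at least 1. *)
have [x [y xy]] := exists_adj ncol; have degx_gt0 := adj_degree_gt0 xy.
pose s := (\sum_(x : H) degree x)%N.
have s_gt0 : (0 < s)%N := leq_trans degx_gt0 (leq_sum_degree x).
have Delta_gt0 : (0 < Delta)%N by rewrite -hDelta (leq_trans degx_gt0) ?leq_degree.
have n_neq0 : n%:R != 0 :> rat.
  by rewrite pnatr_eq0 -lt0n -hn; apply/card_gt0P; exists x.
rewrite -hd /average_degree hn [n%:R * _]mulrC mulfVK // -/s -natrM.
have D_gt0 : 0 < (2 * Delta)%:R :> rat by rewrite ltr0n muln_gt0.
set q := s%:R / _; have q_gt0 : 0 < q by rewrite divr_gt0 // ltr0n.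
have : 0 < Num.ceil q by rewrite ceil_gt0.
(* The ceiling is [k.+1], so the integer exponent in the goal becomes the natural number [k]. *)
case Dq: (Num.ceil q) => [[|k]|] // _.
rewrite intS [1 + _]addrC addrK -exprnP -natrX ltr_nat ltnNge; apply/negP.
move=> /(canonical_ramsey_sum_degree ncol ramsey); rewrite hDelta -/s => le_s.
(* The bound on [s] says that [q <= k], which contradicts the value [k.+1] of its ceiling. *)
have : Num.ceil q <= k by rewrite ceil_le_int ler_pdivrMr // -natrM ler_nat.
by rewrite Dq lez_nat ltnn.
Qed.
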